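(* Assume the set of atomic formulas (= atomic graphs) is non-empty. Then: (a) The schema $G''\supset(-G''\supset H'')$ is not valid: there exist $G,H\in GET$ such that $G''\supset(-G''\supset H'')\notin VT$. (b) The system of existential graphs GET is paraconsistent with respect to the negation $G\mapsto\{G\}$: there exist $G,H\in GET$ such that it is not the case that $G\{G\}\gg H$. (c) The deductive system GT is paraconsistent with respect to the negation $-$: there exist $X,Y\in FT$ such that $Y$ is not a consequence of $\{X,-X\}$ in GT.
   Context: Paraconsistency: a deductive system with negation operator $N$ is paraconsistent when it does not derive all its formulas from $X$ and $NX$. Formulas. $FA$ is a set of atomic formulas. $FT$ is the smallest set containing $FA$ and the constant $\lambda$, and closed under the unary connective $-$ (weak negation) and the binary connective $\supset$. Abbreviations: $\sim X:=X\supset-\lambda$; $+X:=\sim-X$; $\otimes X:=-\sim X$; $X\cup Y:=\sim X\supset Y$; $X\cap Y:=\sim(X\supset\sim Y)$. System GT. Axioms (for all $X,Y,Z\in FT$): Ax1 $\lambda$; Ax2 $X\supset(Y\supset X)$; Ax3 $[X\supset(Y\supset Z)]\supset[(X\supset Y)\supset(X\supset Z)]$; Ax4 $[(X\supset Y)\supset X]\supset X$; Ax5 $-\lambda\supset Z$; Ax6 $(X\supset-\lambda)\supset-X$; Ax7 $[-(X\supset Y)\supset-\lambda]\supset[(-X\supset-\lambda)\supset(-Y\supset-\lambda)]$; Ax+: if $X$ is an instance of one of Ax1,…,Ax7, then $-X\supset-\lambda$ is an axiom. The only rule is modus ponens Mp. $Y$ is a consequence of a set of formulas if $Y$ is derivable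 by Mp from the axioms together with the formulas of the set as assumptions. Models. A model for GT is $(S,Ma,<,V)$ where $S$ is a non-empty set, $Ma\in S$ is the actual world, $<$ is a reflexive binary relation on $S$, and $V:S\times FT\to\{0,1\}$, written $M(X)=V(M,X)$, satisfies for all $M\in S$: $M(\lambda)=1$; $M(X\supset Y)=1$ iff ($M(X)=1$ implies $M(Y)=1$); $M(-X)=1$ iff there is $P\in S$ with $M<P$ and $P(X)=0$. $X\in VT$ means $Ma(X)=1$ in every model for GT. Graphs. $GA=FA$ is the set of atomic graphs. $GET$ is the set of graphs built from atomic graphs and the blank sheet of assertion $\lambda$ by juxtaposition $XY$ (in the same region), continuous cut $(X)$, and broken cut $\{X\}$. As $\lambda$ is blank, it may be inserted or deleted anywhere. $*X:=(\{X\})$. A region is even (odd) if it is surrounded by an even (odd) number of cuts, continuous or broken. Transformation rules (applied to parts of a graph located in the indicated region). R1: $(\{\lambda\})$ may be written on the sheet of assertion. R2: in an even region, $XY\Rightarrow X$; in an odd region, $X\Rightarrow XY$. R3: $Y(X)\Leftrightarrow Y(XY)$ in a region surrounded only by (zero or more) continuous cuts; $X\Leftrightarrow XX$; $*Y(X)\Leftrightarrow *Y(X*Y)$ in a region surrounded by at least one broken cut. Here R3 allows iteration and de-iteration in any such region, even or odd. R4: in an even region, $(X)\Rightarrow\{X\}$; in an odd region, $\{X\}\Rightarrow(X)$. R6: in an even region, $((X))\Rightarrow X$; in an odd region, $X\Rightarrow((X))$. R7: two graphs in the same region may be juxtaposed, and juxtaposed graphs may be separated. R8: $XY\Leftrightarrow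 YX$ in any region. R9: juxtaposition is associative in any region. $X\gg Y$ means $Y$ is obtained from $X$ by finitely many applications of the rules. Translation: $P''=P$ for $P\in GA$; $\lambda''=\lambda$; $(X(Y))''=X''\supset Y''$; $((X)(Y))''=X''\cup Y''$; $\{X\}''=-X''$; $(XY)''=X''\cap Y''$ (juxtaposition); and $(X)''=\sim X''$ for a single continuous cut. *)

(* Defs.v *)
From mathcomp Require Import all_boot.

Set Implicit Arguments.
Unset Strict Implicit.
Unset Printing Implicit Defensive.

Declare Scope fm_scope.
Delimit Scope fm_scope with fm.
Declare Scope gr_scope.
Delimit Scope gr_scope with gr.

(** * Formulas; the type [A] is the set of atoms, FA = GA *)

Inductive fm (A : Type) : Type :=
| Atom of A
| Lam
| Wneg of fm A
| Imp of fm A & fm A.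

Arguments Lam {A}.
Bind Scope fm_scope with fm.
Notation "- X" := (Wneg X) : fm_scope.
Notation "X ⊃ Y" := (Imp X Y) (at level 55, right associativity) : fm_scope.

Section Formulas.
Variable A : Type.
Local Open Scope fm_scope.

Definition Neg (X : fm A) : fm A := X ⊃ - Lam.
Definition Or (X Y : fm A) : fm A := Neg X ⊃ Y.
Definition And (X Y : fm A) : fm A := Neg (X ⊃ Neg Y).

(** * The system GT *)

Inductive basic_axiom : fm A -> Prop :=
| Ax1 : basic_axiom Lam
| Ax2 X Y : basic_axiom (X ⊃ (Y ⊃ X))
| Ax3 X Y Z : basic_axiom ((X ⊃ (Y ⊃ Z)) ⊃ ((X ⊃ Y) ⊃ (X ⊃ Z)))
| Ax4 X Y : basic_axiom (((X ⊃ Y) ⊃ X) ⊃ X)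
| Ax5 Z : basic_axiom (- Lam ⊃ Z)
| Ax6 X : basic_axiom ((X ⊃ - Lam) ⊃ - X)
| Ax7 X Y : basic_axiom
    ((- (X ⊃ Y) ⊃ - Lam) ⊃ ((- X ⊃ - Lam) ⊃ (- Y ⊃ - Lam))).

Inductive gt_axiom : fm A -> Prop :=
| AxBasic X : basic_axiom X -> gt_axiom X
| AxPlus X : basic_axiom X -> gt_axiom (- X ⊃ - Lam).

Inductive consequence (Gam : fm A -> Prop) : fm A -> Prop :=
| ConsAssumption X : Gam X -> consequence Gam X
| ConsAxiom X : gt_axiom X -> consequence Gam X
| ConsMp X Y :
    consequence Gam X -> consequence Gam (X ⊃ Y) -> consequence Gam Y.

(** * Models; [mval M X] is the truth value M(X), with 1 read as [true] *)

Record model : Type := Model {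
  world : Type;
  actual : world;
  acc : world -> world -> Prop;
  acc_refl : forall M, acc M M;
  mval : world -> fm A -> bool;
  mval_lam : forall M, mval M Lam = true;
  mval_imp : forall M X Y,
    mval M (X ⊃ Y) = true <-> (mval M X = true -> mval M Y = true);
  mval_wneg : forall M X,
    mval M (- X) = true <-> exists P, acc M P /\ mval P X = false
}.

Definition valid (X : fm A) : Prop :=
  forall m : model, mval (actual m) X = true.

End Formulas.

(** * Graphs

    A graph is a tree over binary juxtaposition; it is not quotiented, so
    commutativity, associativity and the neutrality of the blank are
    transformation rules below. *)

Inductive graph (A : Type) : Type :=
| GAtom of A
| Blank
| Juxt of graph A & graph A
| Cut of graph A
| Broken of graph A.

Arguments Blank {A}.
Bind Scope gr_scope with graph.
Notation "X ** Y" := (Juxt X Y) (at level 40, left associativity) : gr_scope.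

Section Graphs.
Variable A : Type.
Local Open Scope gr_scope.
Implicit Types X Y Z : graph A.

Definition Star X : graph A := Cut (Broken X).

(** A region of a graph, seen as a graph with a hole; [plug c X] puts [X] in
    the hole. *)

Inductive ctx : Type :=
| Hole
| CJuxtL of ctx & graph A
| CJuxtR of graph A & ctx
| CCut of ctx
| CBroken of ctx.

Fixpoint plug (c : ctx) X : graph A :=
  match c with
  | Hole => X
  | CJuxtL d Y => plug d X ** Y
  | CJuxtR Y d => Y ** plug d X
  | CCut d => Cut (plug d X)
  | CBroken d => Broken (plug d X)
  end.

Fixpoint ncuts (c : ctx) : nat :=
  match c with
  | Hole => 0
  | CJuxtL d _ | CJuxtR _ d => ncuts d
  | CCut d | CBroken d => (ncuts d).+1
  end.

Fixpoint nbroken (c : ctx) : nat :=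
  match c with
  | Hole => 0
  | CJuxtL d _ | CJuxtR _ d | CCut d => nbroken d
  | CBroken d => (nbroken d).+1
  end.

Definition odd_region (c : ctx) : Prop := odd (ncuts c).
Definition even_region (c : ctx) : Prop := ~~ odd (ncuts c).

(** One-way rules: [rule1 c X Y] means X => Y in the region [c]. *)

Inductive rule1 (c : ctx) : graph A -> graph A -> Prop :=
| R2_erase X Y : even_region c -> rule1 c (X ** Y) X
| R2_insert X Y : odd_region c -> rule1 c X (X ** Y)
| R4_even X : even_region c -> rule1 c (Cut X) (Broken X)
| R4_odd X : odd_region c -> rule1 c (Broken X) (Cut X)
| R6_even X : even_region c -> rule1 c (Cut (Cut X)) X
| R6_odd X : odd_region c -> rule1 c X (Cut (Cut X)).

(** Two-way rules: [rule2 c X Y] means X <=> Y in the region [c].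
    [Rblank] is the insertion and deletion of the blank. *)

Inductive rule2 (c : ctx) : graph A -> graph A -> Prop :=
| R3_iter X Y : nbroken c = 0 ->
    rule2 c (Y ** Cut X) (Y ** Cut (X ** Y))
| R3_dup X : rule2 c X (X ** X)
| R3_star X Y : 0 < nbroken c ->
    rule2 c (Star Y ** Cut X) (Star Y ** Cut (X ** Star Y))
| R8 X Y : rule2 c (X ** Y) (Y ** X)
| R9 X Y Z : rule2 c ((X ** Y) ** Z) (X ** (Y ** Z))
| Rblank X : rule2 c (X ** Blank) X.

Definition rule (c : ctx) X Y : Prop :=
  rule1 c X Y \/ rule2 c X Y \/ rule2 c Y X.

(** [derives X Y] is X >> Y: the graph Y can be put on the sheet of assertion
    when one starts with X on it. R7 matters only for graphs standing
    separately on the sheet, since in a tree the content of a cut is already a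
    single juxtaposition. Graphs on the sheet remain available after use; this
    adds nothing, as [R3_dup] copies them. *)

Inductive derives X : graph A -> Prop :=
| GStart : derives X X
| GRule c Y Z :
    derives X (plug c Y) -> rule c Y Z -> derives X (plug c Z)
| R1 : derives X (Cut (Broken Blank))
| R7_join Y Z : derives X Y -> derives X Z -> derives X (Y ** Z)
| R7_left Y Z : derives X (Y ** Z) -> derives X Y
| R7_right Y Z : derives X (Y ** Z) -> derives X Z.

(** The translation G''. A cut is read by the first clause that applies, from
    the most to the least specific: ((X)(Y)), then (X(Y)), then (X). *)

Fixpoint tr (G : graph A) : fm A :=
  match G with
  | GAtom p => Atom p
  | Blank => Lam
  | Juxt X Y => And (tr X) (tr Y)
  | Cut (Juxt (Cut X) (Cut Y)) => Or (tr X) (tr Y)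
  | Cut (Juxt X (Cut Y)) => Imp (tr X) (tr Y)
  | Cut X => Neg (tr X)
  | Broken X => Wneg (tr X)
  end.

End Graphs.

(* Main.v *)
Require Import Defs.
From mathcomp Require Import all_boot.

(** All three parts come from one countermodel. Weak negation says that a
    formula fails at some accessible world, so [X] and [- X] hold together at a
    world where [X] is true and which sees a world where [X] is false; but
    [- λ] holds nowhere. Two worlds that see each other, with every atom true
    at the first and false at the second, therefore make an atom and its weak
    negation true at the actual world while [- λ] is false there.

    This refutes the explosion schema directly, and refutes it as a derived
    consequence because both calculi preserve truth at each world of each
    model. For GT ([consequence_sound]) the axioms hold at every world, which
    is also why [- X ⊃ - λ] holds for an axiom [X]. For graphs
    ([derives_sound]) a graph is read through its translation. Continuous cut
    then is classical negation, whichever clause of the translation applies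
    ([mval_tr_cut]), and broken cut is weak negation. Both reverse entailment
    between graphs ([plug_entails]), so that a rule is sound in a region as soon
    as its two sides entail each other in the direction given by the parity of
    the region ([rule_sound]). *)

Set Implicit Arguments.
Unset Strict Implicit.
Unset Printing Implicit Defensive.

Local Open Scope fm_scope.

(** * Truth values of the connectives *)

Lemma mval_impE (A : Type) (m : model A) (M : world m) (X Y : fm A) :
  mval M (X ⊃ Y) = (mval M X ==> mval M Y).
Proof. by apply/idP/implyP => /mval_imp. Qed.

Lemma mval_wneg_lam (A : Type) (m : model A) (M : world m) :
  mval M (- Lam) = false.
Proof. by apply/negP => /mval_wneg [P [_]]; rewrite mval_lam. Qed.

Lemma mval_neg (A : Type) (m : model A) (M : world m) (X : fm A) :
  mval M (Neg X) = ~~ mval M X.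
Proof. by rewrite mval_impE mval_wneg_lam implybF. Qed.

Lemma mval_or (A : Type) (m : model A) (M : world m) (X Y : fm A) :
  mval M (Or X Y) = mval M X || mval M Y.
Proof. by rewrite mval_impE mval_neg; case: (mval M X). Qed.

Lemma mval_and (A : Type) (m : model A) (M : world m) (X Y : fm A) :
  mval M (And X Y) = mval M X && mval M Y.
Proof. by rewrite mval_neg mval_impE mval_neg; case: (mval M X); case: (mval M Y). Qed.

(** Reflexivity of accessibility: a formula false here is false at some
    accessible world. *)
Lemma mval_neg_wneg (A : Type) (m : model A) (M : world m) (X : fm A) :
  ~~ mval M X -> mval M (- X).
Proof. by move/negbTE=> XF; apply/mval_wneg; exists M; split=> //; apply: acc_refl. Qed.

Lemma mval_wneg_anti (A : Type) (m : model A) (X Y : fm A) :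
  (forall M : world m, mval M X -> mval M Y) ->
  forall M : world m, mval M (- Y) -> mval M (- X).
Proof.
move=> XY M /mval_wneg [P [MP YF]]; apply/mval_wneg; exists P; split=> //.
by apply: contraFF YF => /XY.
Qed.

(** * Soundness of GT *)

(** Only the last two schemata involve accessibility: Ax6 is its reflexivity,
    and Ax7 the distribution of necessity over implication, by contraposition:
    if [- Y] holds because [Y] fails at [P], then [X] or [X ⊃ Y] fails at the
    same [P]. *)
Lemma basic_axiom_sound (A : Type) (m : model A) (M : world m) (X : fm A) :
  basic_axiom X -> mval M X.
Proof.
case=> [|{}X Y|{}X Y Z|{}X Y|Z|{}X|{}X Y]; rewrite ?mval_lam // !mval_impE.
- by case: (mval M X); case: (mval M Y).
- by case: (mval M X); case: (mval M Y); case: (mval M Z).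
- by case: (mval M X); case: (mval M Y).
- by rewrite mval_wneg_lam.
- by rewrite mval_wneg_lam implybF; apply/implyP/mval_neg_wneg.
- rewrite mval_wneg_lam !implybF; apply/implyP => nXY; apply/implyP => nX.
  apply/negP => /mval_wneg [P [MP YF]].
  case XP: (mval P X).
    by case/negP: nXY; apply/mval_wneg; exists P; rewrite mval_impE XP YF.
  by case/negP: nX; apply/mval_wneg; exists P.
Qed.

Lemma gt_axiom_sound (A : Type) (m : model A) (M : world m) (X : fm A) :
  gt_axiom X -> mval M X.
Proof.
case=> {}X aX; first exact: basic_axiom_sound.
rewrite mval_neg; apply/negP => /mval_wneg [P [_]].
by rewrite basic_axiom_sound.
Qed.

Lemma consequence_sound (A : Type) (m : model A) (M : world m)
    (Gam : fm A -> Prop) (Y : fm A) :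
  (forall Z, Gam Z -> mval M Z) -> consequence Gam Y -> mval M Y.
Proof.
move=> GamM; elim=> {Y} [X /GamM //|X|X Y _ MX _]; first exact: gt_axiom_sound.
by rewrite mval_impE MX.
Qed.

(** * Soundness of the graph rules *)

Lemma mval_tr_juxt (A : Type) (m : model A) (M : world m) (X Y : graph A) :
  mval M (tr (Juxt X Y)) = mval M (tr X) && mval M (tr Y).
Proof. exact: mval_and. Qed.

(** The clause for [((X)(Y))] reads [X] and [Y] below two cuts at once, so the
    claim is needed for graphs inside the cuts of [X], and the recursion is on
    all subgraphs instead of the immediate ones. *)
Lemma mval_tr_cut (A : Type) (m : model A) (M : world m) (X : graph A) :
  mval M (tr (Cut X)) = ~~ mval M (tr X).
Proof.
move: X; fix IH 1; case=> [p||X Y|X|X]; try exact: mval_neg.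
case: Y => [q||Y1 Y2|Y|Y].
(* when Y is not a cut, the clause for a single cut applies *)
1-3,5: by case: X => *; exact: mval_neg.
rewrite mval_tr_juxt (IH Y) negb_and negbK.
case: X => [p||X1 X2|X|X]; try by rewrite -implybE; exact: mval_impE.
by rewrite (IH X) negbK; exact: mval_or.
Qed.

Definition entails (A : Type) (m : model A) (X Y : graph A) : Prop :=
  forall M : world m, mval M (tr X) -> mval M (tr Y).

(** Each cut around a region exchanges the roles of the two graphs; stating
    both directions of entailment by one parity lets the induction on the
    region pass through a cut by swapping them. *)
Lemma plug_entails (A : Type) (m : model A) (c : ctx A) (X Y : graph A) :
  (if odd (ncuts c) then entails m Y X else entails m X Y) ->
  entails m (plug c X) (plug c Y).
Proof.
elim: c X Y => [|d IH Z|Z d IH|d IH|d IH] X Y //= XY.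
- by move=> M; rewrite !mval_and => /andP[/(IH _ _ XY) -> ->].
- by move=> M; rewrite !mval_and => /andP[-> /(IH _ _ XY) ->].
- have YX : entails m (plug d Y) (plug d X) by apply: IH; case: odd XY.
  by move=> M; rewrite !mval_tr_cut; apply: contra => /YX.
- have YX : entails m (plug d Y) (plug d X) by apply: IH; case: odd XY.
  exact: mval_wneg_anti.
Qed.

(** R2 is conjunction elimination and R6 double negation; replacing a
    continuous cut by a broken one is where reflexivity is used. *)
Lemma rule1_sound (A : Type) (m : model A) (c : ctx A) (X Y : graph A) :
  rule1 c X Y -> if odd (ncuts c) then entails m Y X else entails m X Y.
Proof.
rewrite /odd_region /even_region.
case=> {X Y} [X Y /negbTE->|X Y ->|X /negbTE->|X ->|X /negbTE->|X ->] M.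
- by rewrite mval_and => /andP[].
- by rewrite mval_and => /andP[].
- by rewrite mval_tr_cut; exact: mval_neg_wneg.
- by rewrite mval_tr_cut; exact: mval_neg_wneg.
- by rewrite !mval_tr_cut negbK.
- by rewrite !mval_tr_cut negbK.
Qed.

(** Iteration copies a graph into a cut of its own region, so both sides of a
    two-way rule have the same truth table in the values of the juxtaposed
    parts at a single world. *)
Lemma rule2_sound (A : Type) (m : model A) (M : world m) (c : ctx A)
    (X Y : graph A) :
  rule2 c X Y -> mval M (tr X) = mval M (tr Y).
Proof.
case=> {X Y} [X Y _|X|X Y _|X Y|X Y Z|X].
- rewrite !mval_tr_juxt !mval_tr_cut mval_tr_juxt.
  by case: (mval M (tr X)); case: (mval M (tr Y)).
- by rewrite mval_tr_juxt andbb.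
- rewrite mval_tr_juxt [RHS]mval_tr_juxt.
  rewrite (mval_tr_cut M X) (mval_tr_cut M (Juxt X _)) mval_tr_juxt.
  by case: (mval M (tr X)); case: (mval M (tr (Star Y))).
- by rewrite !mval_tr_juxt andbC.
- by rewrite !mval_tr_juxt andbA.
- by rewrite mval_tr_juxt mval_lam andbT.
Qed.

Lemma rule_sound (A : Type) (m : model A) (c : ctx A) (X Y : graph A) :
  rule c X Y -> entails m (plug c X) (plug c Y).
Proof.
move=> XY; apply: plug_entails; case: XY => [|[]/rule2_sound XY].
- exact: rule1_sound.
- by case: odd => M; rewrite XY.
- by case: odd => M; rewrite XY.
Qed.

Lemma derives_sound (A : Type) (m : model A) (X Y : graph A) :
  derives X Y -> entails m X Y.
Proof.
move=> XY M MX; elim: XY => {Y} [|c Y Z _ MY YZ||Y Z _ MY _ MZ|Y Z _|Y Z _].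
- exact: MX.
- exact: rule_sound YZ _ MY.
- by rewrite mval_neg; apply/negP => /mval_wneg [P [_]]; rewrite mval_lam.
- by rewrite mval_tr_juxt MY MZ.
- by rewrite mval_tr_juxt => /andP[].
- by rewrite mval_tr_juxt => /andP[].
Qed.

(** * The countermodel *)

(** Each world sees both, so [- X] is true at a world exactly when [X] is false
    at one of the two. *)
Fixpoint two_world_val (A : Type) (w : bool) (X : fm A) : bool :=
  match X with
  | Atom _ => w
  | Lam => true
  | Wneg Y => ~~ (two_world_val true Y && two_world_val false Y)
  | Imp Y Z => two_world_val w Y ==> two_world_val w Z
  end.

Lemma two_world_val_imp (A : Type) (w : bool) (X Y : fm A) :
  two_world_val w (X ⊃ Y) = true <->
  (two_world_val w X = true -> two_world_val w Y = true).
Proof. by split=> [/implyP|/implyP]. Qed.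

Lemma two_world_val_wneg (A : Type) (w : bool) (X : fm A) :
  two_world_val w (- X) = true <->
  exists v : bool, True /\ two_world_val v X = false.
Proof.
rewrite /= negb_and; split=> [/orP[]/negbTE XF|[[] [_ ->]]].
- by exists true.
- by exists false.
- by [].
- by rewrite orbT.
Qed.

Definition two_world_model (A : Type) : model A :=
  @Model A bool true (fun _ _ => True) (fun _ => I) (@two_world_val A)
    (fun _ => erefl) (@two_world_val_imp A) (@two_world_val_wneg A).

(** In each part the explosion is refuted for an atom [a], with [- λ] (the
    broken cut of the blank) as the conclusion that is not reached. *)
Theorem mainTheorem3 (A : Type) (hA : inhabited A) :
  (exists G H : graph A, ~ valid (tr G ⊃ (- tr G ⊃ tr H))%fm) /\
  (exists G H : graph A, ~ derives (Juxt G (Broken G)) H) /\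
  (exists X Y : fm A,
     ~ consequence (fun Z : fm A => Z = X \/ Z = Wneg X) Y).
Proof.
case: hA => a; pose m := two_world_model A.
split; last split.
- exists (GAtom a), (Broken Blank) => /(_ m) //.
- exists (GAtom a), (Broken Blank) => /(@derives_sound A m).
  by move=> /(_ (actual m) isT).
- exists (Atom a), (- Lam) => /(@consequence_sound A m (actual m)).
  suff aM Z : Z = Atom a \/ Z = Wneg (Atom a) -> mval (actual m) Z.
    by move=> /(_ aM).
  by case=> ->.
Qed.
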